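(* There is no algorithm in the radical computation tree model, and no algorithm in the root computation tree model, that for every bipyramid with integer edge lengths (given by its combinatorial structure and edge lengths) computes the coordinates of its geometric realization as a convex polyhedron.
   Context: A bipyramid is a convex polyhedron whose faces are isosceles triangles, with their bases forming a cycle (the equator) and their apexes meeting at two vertices (the poles); here all edges incident to the poles have a common length and all edge lengths are integers. The models are those of Bannister, Devanny, Eppstein and Goodrich: algebraic computation trees whose nodes perform arithmetic operations ($+,-,\times,\div$) on the inputs and previously computed values and branch on comparisons; in the radical computation tree model nodes may additionally compute $k$-th roots of previously computed real values for arbitrary positive integers $k$; in the root computation tree model nodes may additionally compute roots of polynomials of bounded degree (a fixed bound $d$) whose coefficients are previously computed values. *)

(* Defs.v *)
From HB Require Import structures.
From mathcomp Require Import all_boot all_order all_algebra.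
From mathcomp Require Import reals.
Set Implicit Arguments. Unset Strict Implicit. Unset Printing Implicit Defensive.
Import Order.TTheory GRing.Theory Num.Theory.
Local Open Scope ring_scope.

(* Computation trees (Bannister-Devanny-Eppstein-Goodrich).            *)
(* The memory is a sequence of reals, initially the input; every      *)
(* computing node appends its result at the end of the memory;        *)
(* values are referred to by their index in the memory.               *)

Inductive arith_op := OpAdd | OpSub | OpMul | OpDiv.

Inductive ctree : Type :=
  | CLeaf (outs : seq nat)
  | CArith (o : arith_op) (i j : nat) (t : ctree)
  | CRad (k : nat) (i : nat) (t : ctree)
  | CPolyRoot (cs : seq nat) (r : nat) (t : ctree)
      (* the r-th smallest (from 0) distinct real root of the polynomial
         \sum_m v_(cs_m) X^m *)
  | CBranch (i j : nat) (tlt tge : ctree).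

Definition arith_eval (R : realType) (o : arith_op) (x y : R) : R :=
  match o with
  | OpAdd => x + y | OpSub => x - y | OpMul => x * y | OpDiv => x / y
  end.

Definition real_kth_root (R : realType) (k : nat) (x y : R) : Prop :=
  (0 < k)%N /\ y ^+ k = x /\ (odd k \/ 0 <= y).

Definition nth_real_root (R : realType) (p : {poly R}) (r : nat) (y : R) : Prop :=
  p != 0 /\ root p y /\
  exists s : seq R, uniq s /\ size s = r /\
    (forall z, (z \in s) = (root p z && (z < y))).

Definition poly_of_mem (R : realType) (m : seq R) (cs : seq nat) : {poly R} :=
  \poly_(k < size cs) nth 0 m (nth 0%N cs k).

Inductive ceval (R : realType) : ctree -> seq R -> seq R -> Prop :=
  | ev_leaf outs m :
      ceval (CLeaf outs) m [seq nth 0 m o | o <- outs]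
  | ev_arith o i j t m out :
      (o = OpDiv -> nth 0 m j != 0) ->
      ceval t (rcons m (arith_eval o (nth 0 m i) (nth 0 m j))) out ->
      ceval (CArith o i j t) m out
  | ev_rad k i t m y out :
      real_kth_root k (nth 0 m i) y ->
      ceval t (rcons m y) out ->
      ceval (CRad k i t) m out
  | ev_polyroot cs r t m y out :
      nth_real_root (poly_of_mem m cs) r y ->
      ceval t (rcons m y) out ->
      ceval (CPolyRoot cs r t) m out
  | ev_branch_lt i j tl tr m out :
      nth 0 m i < nth 0 m j -> ceval tl m out -> ceval (CBranch i j tl tr) m out
  | ev_branch_ge i j tl tr m out :
      ~ (nth 0 m i < nth 0 m j) -> ceval tr m out -> ceval (CBranch i j tl tr) m out.

Fixpoint radical_tree (t : ctree) : Prop :=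
  match t with
  | CLeaf _ => True
  | CArith _ _ _ t' => radical_tree t'
  | CRad _ _ t' => radical_tree t'
  | CPolyRoot _ _ _ => False
  | CBranch _ _ tl tr => radical_tree tl /\ radical_tree tr
  end.

Fixpoint root_tree (d : nat) (t : ctree) : Prop :=
  match t with
  | CLeaf _ => True
  | CArith _ _ _ t' => root_tree d t'
  | CRad _ _ _ => False
  | CPolyRoot cs _ t' => (size cs <= d.+1)%N /\ root_tree d t'
  | CBranch _ _ tl tr => root_tree d tl /\ root_tree d tr
  end.

(* Vertices: equator 0..n-1 (cycle i -- i+1 mod n), poles n and n+1.  *)

Definition pt3 (R : realType) := (R * R * R)%type.

Definition sub3 (R : realType) (p q : pt3 R) : pt3 R :=
  (p.1.1 - q.1.1, p.1.2 - q.1.2, p.2 - q.2).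
Definition dot3 (R : realType) (p q : pt3 R) : R :=
  p.1.1 * q.1.1 + p.1.2 * q.1.2 + p.2 * q.2.
Definition cross3 (R : realType) (p q : pt3 R) : pt3 R :=
  (p.1.2 * q.2 - p.2 * q.1.2, p.2 * q.1.1 - p.1.1 * q.2,
   p.1.1 * q.1.2 - p.1.2 * q.1.1).
Definition dist2 (R : realType) (p q : pt3 R) : R := dot3 (sub3 p q) (sub3 p q).
Definition orient (R : realType) (p q r s : pt3 R) : R :=
  dot3 (cross3 (sub3 q p) (sub3 r p)) (sub3 s p).

Definition bipyramid_faces (n : nat) : seq (nat * nat * nat) :=
  [seq (n, i, (i.+1 %% n)%N) | i <- iota 0 n] ++
  [seq (n.+1, i, (i.+1 %% n)%N) | i <- iota 0 n].

Definition in_face (f : nat * nat * nat) (w : nat) : bool :=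
  [|| w == f.1.1, w == f.1.2 | w == f.2].

(* P : vertex -> point is a realization as a convex polyhedron of the
   bipyramid with n equator vertices, equator edge lengths a_0..a_(n-1)
   (a_i is the length of edge i -- i+1 mod n) and pole edge length b:
   edge lengths are as prescribed, and every face is a facet, i.e. all
   other vertices lie strictly on one and the same side of its plane. *)
Definition bipyramid_realization (R : realType) (n : nat) (a : nat -> nat)
    (b : nat) (P : nat -> pt3 R) : Prop :=
  (forall i, (i < n)%N -> dist2 (P i) (P (i.+1 %% n)%N) = (a i)%:R ^+ 2) /\
  (forall i, (i < n)%N ->
     dist2 (P n) (P i) = b%:R ^+ 2 /\ dist2 (P n.+1) (P i) = b%:R ^+ 2) /\
  (forall f, f \in bipyramid_faces n -> forall w1 w2,
     (w1 < n.+2)%N -> (w2 < n.+2)%N -> ~~ in_face f w1 -> ~~ in_face f w2 ->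
     0 < orient (P f.1.1) (P f.1.2) (P f.2) (P w1) *
         orient (P f.1.1) (P f.1.2) (P f.2) (P w2)).

(* input of the algorithm: the lengths of all 3n edges, equator edges
   (i, i+1 mod n) first, then the n edges at pole n, then the n edges at
   pole n+1 *)
Definition bipyramid_input (R : realType) (n : nat) (a : nat -> nat) (b : nat)
  : seq R :=
  [seq (a i)%:R | i <- iota 0 n] ++ nseq n b%:R ++ nseq n b%:R.

Definition out_points (R : realType) (out : seq R) (v : nat) : pt3 R :=
  (nth 0 out (3 * v), nth 0 out (3 * v).+1, nth 0 out (3 * v).+2).

(* A family of computation trees (one for each combinatorial type, i.e.
   each number n >= 3 of equator vertices) computes the realization of
   every bipyramid with integer edge lengths. *)
Definition computes_bipyramids (R : realType) (A : nat -> ctree) : Prop :=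
  forall (n : nat) (a : nat -> nat) (b : nat), (3 <= n)%N ->
    (exists P : nat -> pt3 R, bipyramid_realization n a b P) ->
    exists out : seq R,
      ceval (A n) (bipyramid_input R n a b) out /\
      size out = (3 * n.+2)%N /\
      bipyramid_realization n a b (out_points out).

(* Main.v *)
Require Import Defs.
From HB Require Import structures.
From mathcomp Require Import all_boot all_order all_algebra all_field.
From mathcomp Require Import boolp classical_sets reals.
From mathcomp Require Import topology normedtype trigo ring lra zify.
Set Implicit Arguments. Unset Strict Implicit. Unset Printing Implicit Defensive.
Import Order.TTheory GRing.Theory Num.Theory.
Import numFieldNormedType.Exports.
Local Open Scope ring_scope.

(* For an odd prime p take the bipyramid over a cyclic polygon with p + 1 sides of
   length 2 and one side of length 1.  The chord over two sides of length 2 has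
   length 2 |y| with y = 2 cos t, and closing the polygon forces
   sin ((p + 1) t) / sin t = 1/2 (up to replacing y by - y), a polynomial equation
   of degree p in y which is irreducible over the rationals by Eisenstein's
   criterion applied to the reversed polynomial.  So the output of an algorithm
   yields a number of degree p.
   The values computed by a tree generate a tower of real number fields.  In the
   root model each step has degree at most d, so p does not divide the degree of
   the tower when p > d.  In the radical model take p = 3: the equation is then an
   irreducible cubic with at least two real roots, and by the casus irreducibilis
   no root of it lies in a tower of real radicals. *)

(** * Real number fields and radicals *)

Lemma algebraic_irreducible_root (F E : fieldType) (iota : {rmorphism F -> E})
    (z : E) :
  algebraicOver iota z ->
  exists2 r, irreducible_poly r & root (map_poly iota r) z.
Proof.
case=> p nz_p pz.
pose P n := `[< exists q : {poly F},
  [/\ q != 0, root (map_poly iota q) z & size q = n] >].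
have exP: exists n, P n by exists (size p); apply/asboolP; exists p.
case: (ex_minnP exP) => n /asboolP[r [nz_r rz <-]] min_r.
exists r => //; apply/(subfx_irreducibleP rz nz_r) => q qz nz_q.
by apply: min_r; apply/asboolP; exists q.
Qed.

Lemma primitive_element (E : numFieldType) (s : seq E) :
  (forall x, x \in s -> algebraicOver (ratr : rat -> E) x) ->
  exists2 z : E, algebraicOver (ratr : rat -> E) z
    & exists ps, s = [seq (map_poly ratr p).[z] | p <- ps].
Proof.
elim: s => [|x s IH] algs.
  by exists 0; [apply: algebraic0 | exists [::]].
have [y xs_y|z algz [ps Ds]] := IH; first by apply: algs; rewrite inE xs_y orbT.
have [rx nz_rx rx0] := algs x (mem_head _ _).
(* The primitive element comes as [x *+ n] minus the other generator; passing [- z] turns it into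
   [x *+ n + z]. *)
have [rz nz_rz rz0] : algebraicOver (ratr : rat -> E) (- z).
  exact: algebraic_opp.
have [n [[pz Dpz] [px Dpx]]] :=
  pchar0_PET nz_rz rz0 nz_rx rx0 (pchar_num rat).
rewrite opprK in Dpz Dpx.
exists (x *+ n + z).
  apply: algebraic_add => //.
  elim: n {Dpz Dpx} => [|n IHn]; first exact: algebraic0.
  by rewrite mulrS; apply: algebraic_add => //; exists rx.
exists (px :: [seq p \Po - pz | p <- ps]); rewrite /= Dpx; congr (_ :: _).
rewrite Ds -map_comp; apply: eq_map => p /=.
by rewrite map_comp_poly horner_comp raddfN hornerN Dpz opprK.
Qed.

(** Moves finitely many algebraic numbers into an abstract finite extension, where dimensions and
    minimal polynomials over subfields are available: the quotient of [{poly rat}] by an irreducible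
    annihilator of a primitive element. *)
Lemma number_field (E : numFieldType) (s : seq E) :
  (forall x, x \in s -> algebraicOver (ratr : rat -> E) x) ->
  exists (L : fieldExtType rat) (iota : {rmorphism L -> E}) (l : seq L),
    s = map iota l.
Proof.
move=> /primitive_element[z /algebraic_irreducible_root[r irr_r rz] [ps ->]].
exists (SubFieldExtType rz irr_r), (@subfx_inj _ _ (ratr : {rmorphism rat -> E}) z r).
exists [seq subfx_eval (ratr : {rmorphism rat -> E}) z r p | p <- ps].
rewrite -map_comp; apply: eq_map => p /=.
by rewrite subfx_inj_eval // irredp_neq0.
Qed.

(** By Cayley-Hamilton [M ^+ q] is the scalar matrix [c]; take determinants. For a companion matrix
    this controls the norm of a [q]-th root. *)
Lemma det_pow_of_char_poly_dvd (F : fieldType) (n q : nat)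
    (M : 'M[F]_n) (c : F) :
  (char_poly M %| 'X^q - c%:P) -> \det M ^+ q = c ^+ n.
Proof.
case: n => [|n] in M *; first by rewrite det_mx00 expr1n expr0.
case/dvdpP=> h /(congr1 (horner_mx M)).
rewrite rmorphM /= Cayley_Hamilton mulr0 rmorphB rmorphXn /= horner_mx_X.
rewrite horner_mx_C => /subr0_eq Mq; rewrite -(det_scalar n.+1) -Mq.
elim: q {Mq} => [|q IHq]; first by rewrite !expr0 det1.
by rewrite !exprS -mulmxE det_mulmx IHq.
Qed.

Section RealRadicals.
Variables (F0 : fieldType) (L : fieldExtType F0).
Implicit Types (K E : {subfield L}) (x y v : L).

(** By Bezout, [v] is a power of [v ^+ m] divided by a power of [v ^+ n]. *)
Lemma coprime_exp_mem K v (m n : nat) :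
  coprime m n -> v ^+ m \in K -> v ^+ n \in K -> v \in K.
Proof.
have [-> | nz_v] := eqVneq v 0; first by rewrite mem0v.
case: m => [|m] co_mn vm vn.
  by move: co_mn; rewrite /coprime gcd0n => /eqP n1; rewrite n1 expr1 in vn.
case: (egcdnP n (ltn0Sn m)) => a b eq_ab _.
rewrite (eqP co_mn) in eq_ab.
have ->: v = (v ^+ m.+1) ^+ a / (v ^+ n) ^+ b.
  by rewrite -!exprM mulnC eq_ab mulnC exprD expr1 [_ * v]mulrC mulfK // expf_neq0.
by rewrite rpredM // ?rpredV rpredX.
Qed.

Lemma minPoly_conj K x y : root (minPoly K x) y -> minPoly K y = minPoly K x.
Proof.
move=> xy; have := minPoly_irr (minPolyOver K y) (minPoly_dvdp (minPolyOver K x) xy).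
case/orP=> [|y1]; last by have:= root_minPoly K y; rewrite (eqp_root y1) (negPf (root1 _)).
by rewrite eqp_monic ?monic_minPoly // => /eqP.
Qed.

Lemma root_minPoly_trans K x y (p : {poly L}) :
  p \is a polyOver K -> root p x -> root (minPoly K x) y -> root p y.
Proof. by move=> Kp px; apply: root_dvdp; apply: minPoly_dvdp. Qed.

Lemma minPoly_eq_deg K E x :
  (K <= E)%VS -> adjoin_degree E x = adjoin_degree K x -> minPoly E x = minPoly K x.
Proof.
move=> sKE eqd; apply/eqP; rewrite -eqp_monic ?monic_minPoly //.
by rewrite -dvdp_size_eqp ?minPolyS // !size_minPoly eqd.
Qed.

Variables (R : realDomainType) (iota : {rmorphism L -> R}).

(** The order on [R] excludes nontrivial [q]-th roots of unity: the absolute values of the images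
    agree, and for odd [q] so do the signs. *)
Lemma real_expr_inj x y (q : nat) : odd q -> x ^+ q = y ^+ q -> x = y.
Proof.
move=> odd_q eq_xy; have q_gt0 := odd_gt0 odd_q.
apply: (fmorph_inj iota); move/(congr1 iota): eq_xy; rewrite !rmorphXn /=.
move: (iota x) (iota y) => {}x {}y eq_xy.
have: (`|x| == `|y|) by rewrite -(eqrXn2 q_gt0) // -!normrX eq_xy.
rewrite eqr_norm2 => /orP[/eqP // | /eqP xNy].
move/eqP: eq_xy; rewrite xNy exprNn -signr_odd odd_q expr1 mulN1r eq_sym.
by rewrite -addr_eq0 -mulr2n mulrn_eq0 expf_eq0 q_gt0 => /eqP ->; rewrite oppr0.
Qed.

(* If the degree [e] of [v] were less than [q], the norm [u] of [v] would satisfy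
   [u ^+ q = (v ^+ e) ^+ q], hence [u = +- v ^+ e] in the reals, and Bezout for
   [e] and [q] would put [v] in [K]. *)
Lemma adjoin_degree_real_root K v (q : nat) :
  prime q -> v ^+ q \in K -> v \notin K -> adjoin_degree K v = q.
Proof.
move=> q_pr vqK v'K; set e := adjoin_degree K v.
pose g := minPoly K v.
have szg : size g = e.+1 by rewrite size_minPoly.
have Kc : ('X^q - (v ^+ q)%:P : {poly L}) \is a polyOver K.
  by rewrite rpredB ?rpredX ?polyOverX ?polyOverC.
have dvg : g %| 'X^q - (v ^+ q)%:P.
  by apply: minPoly_dvdp => //; rewrite rootE !hornerE subrr.
have le_eq : (e <= q)%N.
  have:= dvdp_leq _ dvg; rewrite szg size_XnsubC ?prime_gt0 //; apply.
  by rewrite -size_poly_eq0 size_XnsubC // prime_gt0.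
apply/eqP; rewrite eqn_leq le_eq leqNgt; apply/negP=> lt_eq.
case/negP: v'K; apply: (coprime_exp_mem (m := e) (n := q)) => //.
  rewrite coprime_sym prime_coprime //; apply/negP=> /(dvdn_leq (ltn0Sn _)).
  by rewrite leqNgt lt_eq.
have gM := companionmxK (monic_minPoly K v).
have := @det_pow_of_char_poly_dvd _ _ q (companionmx g) (v ^+ q).
rewrite gM => /(_ dvg) detq.
have {}detq : \det (companionmx g) ^+ q = (v ^+ e) ^+ q.
  by rewrite detq szg -!exprM mulnC.
have detK : \det (companionmx g) \in K.
  have := char_poly_det (companionmx g); rewrite gM => g0.
  have : g`_0 \in K by apply/polyOverP/minPolyOver.
  by rewrite g0 rpredMsign.
have: `|iota (\det (companionmx g))| == `|iota (v ^+ e)|.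
  by rewrite -(eqrXn2 (prime_gt0 q_pr)) // -!normrX -!rmorphXn detq.
rewrite eqr_norm2 => /orP[] /eqP; last rewrite -rmorphN.
  by move/fmorph_inj <-.
by move/fmorph_inj=> eq_det; rewrite -rpredN -eq_det.
Qed.

(** [v] has degree [q] over both [K] and [K(x)]. Counting the dimension of [K(x, v)] in two ways
    shows that adjoining [v] keeps the degree of [x]. *)
Lemma minPoly_adjoin_radical_notin K x v (q : nat) :
  prime q -> v ^+ q \in K -> v \notin <<K; x>>%VS ->
  minPoly <<K; v>> x = minPoly K x.
Proof.
move=> q_pr vqK v'Kx.
have sKKx := subv_adjoin K x; have sKKv := subv_adjoin K v.
have v'K : v \notin K by apply: contra v'Kx; apply: (subvP sKKx).
apply: minPoly_eq_deg => //.
have degKv := adjoin_degree_real_root q_pr vqK v'K.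
have degKxv := adjoin_degree_real_root q_pr (subvP sKKx _ vqK) v'Kx.
have /eqP := congr1 (fun V => \dim V) (adjoinC K x v).
rewrite /= !dim_Fadjoin degKv degKxv [(_ * (q * _))%N]mulnCA.
rewrite eqn_pmul2l ?prime_gt0 // eqn_pmul2r ?adim_gt0 // => /eqP ->.
by [].
Qed.

(* If [v] lies in both [K(x)] and [K(y)], then it is the same polynomial [h] in [x]
   and in [y], because real [q]-th roots are unique for odd [q]; inverting [h]
   gives [x = y]. *)
Lemma casus_irreducibilis_step K x y v (q : nat) :
  prime q -> v ^+ q \in K -> odd (adjoin_degree K x) -> 
  prime (adjoin_degree K x) ->
  x != y -> root (minPoly K x) y ->
  minPoly <<K; v>> x = minPoly K x.
Proof.
move=> q_pr vqK p_odd p_pr nxy xy; set p := adjoin_degree K x in p_odd p_pr.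
have [vKx|] := boolP (v \in <<K; x>>%VS); last first.
  by move=> v_Kx; apply: minPoly_adjoin_radical_notin q_pr vqK v_Kx.
have eq_yx := minPoly_conj xy.
(* If [v] is outside [K(y)], the minimal polynomial of [y] is unchanged over [K(v)]; since [x] is a
   root of it, it is that of [x] too. *)
have [vKy|v'Ky] := boolP (v \in <<K; y>>%VS); last first.
  have := minPoly_adjoin_radical_notin q_pr vqK v'Ky; rewrite eq_yx => eqv.
  by rewrite -eqv; apply: minPoly_conj; rewrite eqv root_minPoly.
have [vK | v'K] := boolP (v \in K); first by rewrite (Fadjoin_idP vK).
have degKv := adjoin_degree_real_root q_pr vqK v'K.
have sKvKx : (<<K; v>> <= <<K; x>>)%VS.
  by apply/FadjoinP; split=> //; apply: subv_adjoin.
(* The degree [q] of [K(v)] over [K] divides the degree [p] of [K(x)], and both are prime. *)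
have eq_qp : q = p.
  have := field_dimS sKvKx; rewrite !dim_Fadjoin degKv.
  by rewrite dvdn_pmul2r ?adim_gt0 // dvdn_prime2 // => /eqP.
have eq_Kvx : <<K; v>>%VS = <<K; x>>%VS.
  by apply/eqP; rewrite eqEdim sKvKx !dim_Fadjoin degKv eq_qp /=.
have xKv : x \in <<K; v>>%VS by rewrite eq_Kvx memv_adjoin.
have /Fadjoin_polyP[h Kh vh] := vKx.
have /Fadjoin_polyP[k Kk xk] := xKv.
have hy : h.[y] = v.
  apply: (@real_expr_inj _ _ q); first by rewrite eq_qp.
  have Kg : h ^+ q - (v ^+ q)%:P \is a polyOver K.
    by rewrite rpredB ?rpredX ?polyOverC.
  have: root (h ^+ q - (v ^+ q)%:P) y.
    by apply: root_minPoly_trans xy => //; rewrite rootE !hornerE -vh subrr.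
  by rewrite rootE !hornerE subr_eq0 => /eqP.
have: root (k \Po h - 'X) y.
  apply: root_minPoly_trans xy.
    by rewrite rpredB ?polyOverX // polyOver_comp.
  by rewrite rootE !hornerE horner_comp -vh -xk subrr.
by rewrite rootE !hornerE horner_comp hy -xk subr_eq0 => /eqP ?; case/eqP: nxy.
Qed.
End RealRadicals.

(** * Towers generated by a computation *)

Section Tower.
Variable R : realType.
Implicit Types (s m : seq R) (x v : R).

(** The intersection of all subfields containing [s]: membership is proved or used without writing
    elements as rational expressions. *)
Definition gen (s : seq R) : {pred R} :=
  [pred x | `[< forall P : {pred R},
      divring_closed P -> {subset s <= P} -> x \in P >]].

Lemma genP s x : reflect (forall P : {pred R},
  divring_closed P -> {subset s <= P} -> x \in P) (x \in gen s).
Proof. exact: asboolP. Qed.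

Fact gen_divring_closed s : divring_closed (gen s).
Proof.
split=> [|x y /genP Px /genP Py|x y /genP Px /genP Py].
- by apply/genP => P [].
- by apply/genP => P cP sP; have [_ B _] := cP; apply: B; [apply: Px | apply: Py].
- by apply/genP => P cP sP; have [_ _ M] := cP; apply: M; [apply: Px | apply: Py].
Qed.

HB.instance Definition _ s :=
  GRing.isDivringClosed.Build R (gen s) (gen_divring_closed s).

Lemma mem_gen s : {subset s <= gen s}.
Proof. by move=> x sx; apply/genP => P _; apply. Qed.

Lemma nth_gen s s' i : {subset s <= gen s'} -> nth 0 s i \in gen s'.
Proof.
move=> ss'; have [lt_is|le_si] := ltnP i (size s).
  by apply: ss'; rewrite mem_nth.
by rewrite nth_default ?rpred0.
Qed.

(** Follows the growth of a memory, with each new value appended at the end. The relation [step] is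
    a parameter so that both models share the definition. *)
Inductive tower (step : seq R -> R -> Prop) : seq R -> Prop :=
  | tower_nil : tower step [::]
  | tower_rcons s v : tower step s -> step s v -> tower step (rcons s v).

Definition radical_step s v := exists2 k, (0 < k)%N & v ^+ k \in gen s.

Definition root_step (d : nat) s v :=
  exists p : {poly R},
    [/\ p != 0, (size p <= d.+1)%N, p \is a polyOver (gen s) & root p v].

Lemma gen_radical_step s v : v \in gen s -> radical_step s v.
Proof. by exists 1%N. Qed.

Lemma radical_root_step s v k :
  (0 < k)%N -> v ^+ k \in gen s -> root_step k s v.
Proof.
move=> k_gt0 vk; exists ('X^k - (v ^+ k)%:P).
have sz : size ('X^k - (v ^+ k)%:P : {poly R}) = k.+1 by rewrite size_XnsubC.
split; rewrite ?sz //; first by rewrite -size_poly_eq0 sz.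
  by rewrite rpredB ?rpredX ?polyOverX ?polyOverC.
by rewrite rootE !hornerE subrr.
Qed.

Lemma root_stepW d d' s v : (d <= d')%N -> root_step d s v -> root_step d' s v.
Proof.
by move=> le_dd' [p [? szp ? ?]]; exists p; split=> //; apply: leq_trans szp _.
Qed.

Lemma gen_root_step d s v : (0 < d)%N -> v \in gen s -> root_step d s v.
Proof. by move=> d_gt0 sv; apply/(root_stepW d_gt0)/radical_root_step. Qed.

(** Integers lie in every generated field, so an integer input is a tower in either model. *)
Lemma tower_nat step s :
  (forall s' v, v \in gen s' -> step s' v) ->
  (forall x, x \in s -> exists n, x = n%:R) -> tower step s.
Proof.
move=> genW; elim/last_ind: s => [|s x IHs] nats; first exact: tower_nil.
apply: tower_rcons; first by apply: IHs => y sy; apply: nats; rewrite mem_rcons inE sy orbT.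
by apply: genW; have [|n ->] := nats x; rewrite ?mem_rcons ?mem_head ?rpred_nat.
Qed.

Lemma tower_input step n a b :
  (forall s' v, v \in gen s' -> step s' v) -> tower step (bipyramid_input R n a b).
Proof.
move=> genW; apply: tower_nat => // x; rewrite !mem_cat !mem_nseq.
by case/or3P=> [/mapP[i _ ->]|/andP[_ /eqP->]|/andP[_ /eqP->]]; eexists.
Qed.

Lemma arith_eval_gen o i j m : arith_eval o (nth 0 m i) (nth 0 m j) \in gen m.
Proof.
have g k : nth 0 m k \in gen m by apply/nth_gen/mem_gen.
by case: o => /=; [apply: rpredD|apply: rpredB|apply: rpredM|apply: rpred_div].
Qed.

Lemma leaf_gen outs m : {subset [seq nth 0 m o | o <- outs] <= gen m}.
Proof. by move=> _ /mapP[o _ ->]; apply/nth_gen/mem_gen. Qed.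

(** Along the branch that is followed the memory only grows, and its final state is the tower
    sought. An arithmetic operation is a radical step of exponent 1. *)
Lemma ceval_radical_tower t m out :
  ceval t m out -> radical_tree t -> tower radical_step m ->
  exists2 m', tower radical_step m' & {subset out <= gen m'}.
Proof.
elim=> {t m out} [outs m|o i j t m out _ _ IH|k i t m y out [k_gt0 [yk _]] _ IH
  |cs r t m y out _ _ _ []|i j tl tr m out _ _ IH|i j tl tr m out _ _ IH] /=.
- by move=> _ tm; exists m => //; apply: leaf_gen.
- move=> rt tm; apply: IH rt _; apply: tower_rcons tm _.
  by apply: gen_radical_step; apply: arith_eval_gen.
- move=> rt tm; apply: IH rt _; apply: tower_rcons tm _.
  by exists k => //; rewrite yk; apply/nth_gen/mem_gen.
- by case=> rl _; apply: IH.
- by case=> _ rr; apply: IH.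
Qed.

Lemma poly_of_mem_over m cs : poly_of_mem m cs \is a polyOver (gen m).
Proof.
apply/polyOverP => i; rewrite coef_poly.
by case: ifP => _; rewrite ?rpred0 //; apply/nth_gen/mem_gen.
Qed.

(** An arithmetic operation counts as a root of degree 1, whence [0 < d'] even when [d] is 0. The
    freedom in [d'] leaves room for one square root to be added later. *)
Lemma ceval_root_tower d d' t m out : (0 < d')%N -> (d <= d')%N ->
  ceval t m out -> root_tree d t -> tower (root_step d') m ->
  exists2 m', tower (root_step d') m' & {subset out <= gen m'}.
Proof.
move=> d'_gt0 le_d.
elim=> {t m out} [outs m|o i j t m out _ _ IH|k i t m y out _ _ _ []
  |cs r t m y out [nz_p [py _]] _ IH|i j tl tr m out _ _ IH|i j tl tr m out _ _ IH] /=.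
- by move=> _ tm; exists m => //; apply: leaf_gen.
- move=> rt tm; apply: IH rt _; apply: tower_rcons tm _.
  by apply: gen_root_step => //; apply: arith_eval_gen.
- case=> sz_cs rt tm; apply: IH rt _; apply: tower_rcons tm _.
  exists (poly_of_mem m cs); split=> //; last exact: poly_of_mem_over.
  by apply: leq_trans (size_poly _ _) (leq_trans sz_cs _).
- by case=> rl _; apply: IH.
- by case=> _ rr; apply: IH.
Qed.

Local Notation algQ := (algebraicOver (ratr : rat -> R)).

Lemma gen_algebraic s x : (forall y, y \in s -> algQ y) -> x \in gen s -> algQ x.
Proof.
move=> algs /genP/(_ [pred y | `[< algQ y >]]) algx; apply/asboolP/algx.
  split; first by apply/asboolP; apply: algebraic1.
    by move=> y z /asboolP ? /asboolP ?; apply/asboolP; apply: algebraic_sub.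
  by move=> y z /asboolP ? /asboolP ?; apply/asboolP; apply: algebraic_div.
by move=> y /algs ?; apply/asboolP.
Qed.

(** A root of a polynomial with algebraic coefficients is algebraic. The degree is existential at
    each step so that radical towers are covered too. *)
Lemma tower_algebraic s : 
  tower (fun s v => exists d, root_step d s v) s -> forall x, x \in s -> algQ x.
Proof.
elim=> {s} [|s v _ IHs [d [p [nz_p _ sp pv]]]] x //.
rewrite mem_rcons inE => /predU1P[->|/IHs //].
apply/integral_algebraic/(integral_root nz_p pv).
move=> _ /(nthP 0)[i _ <-]; apply/integral_algebraic/(gen_algebraic IHs).
exact/polyOverP.
Qed.

Lemma towerW (st st' : seq R -> R -> Prop) s :
  (forall s v, st s v -> st' s v) -> tower st s -> tower st' s.
Proof.
by move=> W; elim=> [|{}s v _ IHs /W]; [apply: tower_nil | apply: tower_rcons].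
Qed.

Section NumberField.
Variables (L : fieldExtType rat) (iota : {rmorphism L -> R}).

(** The image of [<<1 & l>>] under [iota] is one of the subfields intersected in [gen]. *)
Lemma gen_preimage (l : seq L) x : x \in gen (map iota l) ->
  exists2 u, u \in <<1 & l>>%VS & x = iota u.
Proof.
pose P := [pred y | `[< exists2 u, u \in <<1 & l>>%VS & y = iota u >]].
move=> /genP/(_ P) Px; apply/asboolP/Px.
  split; first by apply/asboolP; exists 1; rewrite ?rmorph1 ?mem1v.
    move=> y z /asboolP[u uK ->] /asboolP[v vK ->]; apply/asboolP.
    by exists (u - v); rewrite ?rmorphB ?rpredB.
  move=> y z /asboolP[u uK ->] /asboolP[v vK ->]; apply/asboolP.
  by exists (u / v); rewrite ?fmorph_div ?rpred_div.
move=> _ /mapP[u ul ->]; apply/asboolP; exists u => //.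
by have /Fadjoin_seqP[] := subvv <<1 & l>>%VS => _; apply.
Qed.

Lemma gen_poly_preimage (l : seq L) (p : {poly R}) :
  p \is a polyOver (gen (map iota l)) ->
  exists2 g : {poly L}, g \is a polyOver <<1 & l>>%VS & p = map_poly iota g.
Proof.
elim/poly_ind: p => [|p c IHp] sp.
  by exists 0; rewrite ?rpred0 // rmorph0.
have /gen_preimage[u uK c_u] : c \in gen (map iota l).
  by have := polyOverP sp 0%N; rewrite coefD coefMX coefC add0r.
have [|g gK ->] := IHp.
  apply/polyOverP => i; have := polyOverP sp i.+1.
  by rewrite coefD coefMX coefC addr0.
exists (g * 'X + u%:P); first by rewrite rpredD ?rpredM ?polyOverX ?polyOverC.
by rewrite rmorphD rmorphM /= map_polyX map_polyC /= -c_u.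
Qed.

End NumberField.

Lemma minPoly1_eqp (L : fieldExtType rat) (iota : {rmorphism L -> R}) 
  (r : {poly rat}) (u : L) :
  irreducible_poly r -> root (map_poly ratr r) (iota u) ->
  minPoly 1 u %= map_poly (in_alg L) r.
Proof.
move=> [_ irr_r] ru.
have {}ru : root (map_poly (in_alg L) r) u.
  rewrite -(fmorph_root iota) -map_poly_comp; congr (root _ _): ru.
  by apply: eq_map_poly => a /=; rewrite alg_num_field fmorph_rat.
have := minPoly_dvdp (alg_polyOver 1%AS r) ru.
have /polyOver1P[g Dg] := minPolyOver 1 u.
rewrite Dg dvdp_map eqp_map => /irr_r; apply.
by rewrite -(size_map_poly (in_alg L)) -Dg size_minPoly.
Qed.

Lemma irreducible_adjoin_degree (L : fieldExtType rat) (iota : {rmorphism L -> R}) 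
  (r : {poly rat}) (u : L) :
  irreducible_poly r -> root (map_poly ratr r) (iota u) ->
  (adjoin_degree 1 u).+1 = size r.
Proof.
move=> irr_r /(minPoly1_eqp irr_r)/eqp_size.
by rewrite size_minPoly size_map_poly.
Qed.

(** The dimension of the tower is a product of degrees at most [d], hence prime to [p], whereas the
    subfield generated by [x] has dimension [p], which would divide it. *)
Theorem root_tower_degree d s x (r : {poly rat}) (p : nat) :
  tower (root_step d) s -> x \in gen s -> irreducible_poly r -> 
  root (map_poly ratr r) x -> prime p -> size r = p.+1 -> (d < p)%N -> False.
Proof.
move=> ts sx irr_r rx p_pr sz_r lt_dp.
have /number_field[L [iota [l Ds]]] : forall y, y \in s -> algQ y.
  by apply/tower_algebraic/towerW/ts => ? ? ?; exists d.
have [u uK xu] : exists2 u, u \in <<1 & l>>%VS & x = iota u.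
  by apply: gen_preimage; rewrite -Ds.
rewrite xu in rx.
have deg_u : adjoin_degree 1 u = p.
  by apply/succn_inj; rewrite (irreducible_adjoin_degree irr_r rx).
have : (p %| \dim <<1 & l>>)%N.
  have /field_dimS : (<<1; u>> <= <<1 & l>>)%VS by rewrite sub_adjoin1v.
  by rewrite dim_Fadjoin deg_u dimv1 muln1.
apply/negP; elim: ts l Ds {uK} => {s sx} [|s v _ IHs [g [nz_g sz_g sg gv]]] l Ds.
  by case: l Ds => // _; rewrite Fadjoin_nil dimv1 dvdn1 gtn_eqF ?prime_gt1.
case/lastP: l Ds => [|l w]; first by case: (s).
rewrite map_rcons => /rcons_inj[Ds Dv].
rewrite adjoin_rcons dim_Fadjoin Euclid_dvdM // negb_or (IHs l Ds) andbT.
apply/negP=> /(dvdn_leq (ltn0Sn _)); apply/negP; rewrite -ltnNge.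
rewrite Ds in sg; have [h hK Dg] := gen_poly_preimage sg.
have hw : root h w by rewrite -(fmorph_root iota) -Dg -Dv.
have nz_h : h != 0 by rewrite -(map_poly_eq0 iota) -Dg.
apply: leq_ltn_trans lt_dp; rewrite -ltnS -size_minPoly.
apply: leq_trans (dvdp_leq nz_h (minPoly_dvdp hK hw)) _.
by rewrite -(size_map_poly iota) -Dg.
Qed.

(** Induction on the exponent: for a prime divisor [q] of [k], first adjoin [w = v ^+ (k %/ q)], a
    [q]-th root, and then [v], a root of smaller exponent over [K(w)]. Since [w] is a power of [v],
    the result is [K(v)]. *)
Lemma minPoly_adjoin_radical (L : fieldExtType rat) (iota : {rmorphism L -> R})
    (K : {subfield L}) (x y v : L) (k : nat) :
  (0 < k)%N -> v ^+ k \in K ->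
  odd (adjoin_degree K x) -> prime (adjoin_degree K x) ->
  x != y -> root (minPoly K x) y -> minPoly <<K; v>> x = minPoly K x.
Proof.
elim/ltn_ind: k K => k IHk K k_gt0 vk p_odd p_pr nxy xy.
have [k1|k_gt1] := leqP k 1.
  have {k_gt0 k1} k1 : k = 1%N by apply/eqP; rewrite eqn_leq k1.
  by rewrite k1 expr1 in vk; rewrite (Fadjoin_idP vk).
have q_pr := pdiv_prime k_gt1; set q := pdiv k in q_pr.
have Dk : k = (k %/ q * q)%N by rewrite divnK ?pdiv_dvd.
rewrite Dk exprM in vk.
have eq1 := casus_irreducibilis_step iota q_pr vk p_odd p_pr nxy xy.
set w := v ^+ (k %/ q) in vk eq1.
have eq_deg : adjoin_degree <<K; w>> x = adjoin_degree K x.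
  by apply/succn_inj; rewrite -!size_minPoly eq1.
have <- : <<<<K; w>>; v>>%VS = <<K; v>>%VS.
  rewrite adjoinC; apply/Fadjoin_idP.
  by rewrite rpredX // memv_adjoin.
rewrite -eq1.
have lt_k : (k %/ q < k)%N by rewrite ltn_Pdiv ?prime_gt1.
have gt0_k : (0 < k %/ q)%N by rewrite divn_gt0 ?prime_gt0 // pdiv_leq.
have wK : v ^+ (k %/ q) \in <<K; w>>%AS by apply: memv_adjoin.
have := IHk _ lt_k <<K; w>>%AS gt0_k wK.
by rewrite eq_deg eq1 => /(_ p_odd p_pr nxy xy).
Qed.

(** Casus irreducibilis: a second real root [y] would preserve the minimal polynomial of [x] at
    every radical step, so [x] could never enter the tower. *)
Theorem radical_tower_one_root s x y (r : {poly rat}) (p : nat) :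
  tower radical_step s -> x \in gen s -> irreducible_poly r -> 
  root (map_poly ratr r) x -> root (map_poly ratr r) y ->
  prime p -> odd p -> size r = p.+1 -> x = y.
Proof.
move=> ts sx irr_r rx ry p_pr p_odd sz_r; apply/eqP/negPn/negP=> nxy.
(* The ambient field must contain the conjugate [y], although the tower itself need not; hence [z]
   is kept apart from [l]. *)
have /number_field[L [iota [[|z l] // [Dy Ds]]]] :
    forall z, z \in y :: s -> algQ z.
  move=> z; rewrite inE => /predU1P[->|]; first by exists r; rewrite ?irredp_neq0.
  apply: tower_algebraic z; apply: towerW ts => ? v [k k_gt0 vk].
  by exists k; apply: radical_root_step.
have [u uK xu] : exists2 u, u \in <<1 & l>>%VS & x = iota u.
  by apply: gen_preimage; rewrite -Ds.
rewrite xu in rx; rewrite Dy in ry.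
have deg_u : adjoin_degree 1 u = p.
  by apply/succn_inj; rewrite (irreducible_adjoin_degree irr_r rx).
have nuz : u != z by apply: contraNneq nxy => uz; rewrite xu Dy uz.
have uz : root (minPoly 1 u) z.
  rewrite (eqp_root (minPoly1_eqp irr_r rx)) -(fmorph_root iota) -map_poly_comp.
  congr (root _ _): ry.
  by apply: eq_map_poly => a /=; rewrite alg_num_field fmorph_rat.
(* This suffices because [u] lies in [<<1 & l>>] and so has degree 1 over it, not the prime degree
   [p]. *)
suffices minu : minPoly <<1 & l>> u = minPoly 1 u.
  have : adjoin_degree <<1 & l>> u = p.
    by apply/succn_inj; rewrite -size_minPoly minu size_minPoly deg_u.
  move: p_pr uK; rewrite -adjoin_deg_eq1 => p_pr /eqP deg1.
  by rewrite deg1 => p1; rewrite -p1 in p_pr.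
elim: ts l Ds {uK} => {s sx Dy} [|s v _ IHs [k k_gt0 vk]] l Ds.
  by case: l Ds => // _; rewrite Fadjoin_nil.
case/lastP: l Ds => [|l w]; first by case: (s).
rewrite map_rcons => /rcons_inj[Ds Dv].
have minu := IHs l Ds; rewrite adjoin_rcons -minu.
have eq_deg : adjoin_degree <<1 & l>> u = p.
  by apply/succn_inj; rewrite -size_minPoly minu size_minPoly deg_u.
apply: (@minPoly_adjoin_radical _ iota _ _ z _ k); rewrite ?eq_deg ?minu //.
rewrite Dv -rmorphXn Ds in vk; have [t tK /fmorph_inj ->] := gen_preimage vk.
by [].
Qed.

End Tower.

(** * The polynomial of the pyramid *)

(* If [y = 2 cos t] then [chord y k = sin (k t) / sin t], the length of a chord
   spanning [k] consecutive unit sides of a cyclic polygon. *)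
Fixpoint chord (R : pzRingType) (y : R) (k : nat) : R :=
  match k with
  | 0%N => 0
  | k'.+1 => if k' is k''.+1 then y * chord y k' - chord y k'' else 1
  end.

Lemma chordSS (R : pzRingType) (y : R) k :
  chord y k.+2 = y * chord y k.+1 - chord y k.
Proof. by []. Qed.

(** As a polynomial in [y], [chord y k.+1] has the parity of [k]; this later trades the sign of a
    chord for that of [y]. *)
Lemma chord_opp (R : comPzRingType) (y : R) k :
  chord (- y) k.+1 = (-1) ^+ k * chord y k.+1.
Proof.
suff: chord (- y) k.+1 = (-1) ^+ k * chord y k.+1 /\
      chord (- y) k.+2 = (-1) ^+ k.+1 * chord y k.+2 by case.
elim: k => [|k [IH1 IH2]]; first by rewrite !chordSS /=; split; ring.
split=> //; rewrite chordSS IH1 IH2 [in RHS]chordSS !exprS; ring.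
Qed.

(** A linear recurrence for the squares, to be matched with the one that squared distances satisfy
    in a realization. *)
Lemma chord_sqr (R : comPzRingType) (y : R) k :
  chord y k.+2 ^+ 2 = (y ^+ 2 - 2) * chord y k.+1 ^+ 2 - chord y k ^+ 2 + 2.
Proof.
(* An invariant of the recurrence, which eliminates the cross term; for [y = 2 cos t] it is the law
   of cosines. *)
have inv : chord y k.+1 ^+ 2 + chord y k ^+ 2 - y * chord y k * chord y k.+1 = 1.
  elim: k => [|k IHk]; first by rewrite /=; ring.
  by rewrite -IHk chordSS; ring.
rewrite -[X in _ = _ + X]mulr1 -[X in _ = _ + _ * X]inv chordSS; ring.
Qed.

(** For [k > 0] this is [x ^+ k.-1 * chord x^-1 k] with denominators cleared, the reversed
    polynomial. Being defined over any ring, it serves at ['X] and at numbers alike. *)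
Fixpoint rchord (R : pzRingType) (x : R) (k : nat) : R :=
  match k with
  | 0%N => 0
  | k'.+1 => if k' is k''.+1 then rchord x k' - x ^+ 2 * rchord x k'' else 1
  end.

Lemma rchordSS (R : pzRingType) (x : R) k :
  rchord x k.+2 = rchord x k.+1 - x ^+ 2 * rchord x k.
Proof. by []. Qed.

Lemma rchord_chord (R : fieldType) (x : R) k :
  x != 0 -> x * rchord x k = x ^+ k * chord x^-1 k.
Proof.
move=> nz_x; suff: x * rchord x k = x ^+ k * chord x^-1 k /\
  x * rchord x k.+1 = x ^+ k.+1 * chord x^-1 k.+1 by case.
elim: k => [|k [IH1 IH2]]; first by rewrite /=; split; ring.
split=> //; rewrite rchordSS chordSS mulrBr IH2 mulrCA IH1 !exprS.
by field.
Qed.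

Lemma rmorph_rchord (R S : pzRingType) (f : {rmorphism R -> S}) (x : R) k :
  f (rchord x k) = rchord (f x) k.
Proof.
suff: f (rchord x k) = rchord (f x) k /\ f (rchord x k.+1) = rchord (f x) k.+1.
  by case.
elim: k => [|k [IH1 IH2]]; first by rewrite /= rmorph0 rmorph1.
by split=> //; rewrite !rchordSS rmorphB rmorphM rmorphXn IH1 IH2.
Qed.

Lemma size_rchordX k : (size (rchord ('X : {poly int}) k) <= k)%N.
Proof.
suff: (size (rchord ('X : {poly int}) k) <= k)%N /\
      (size (rchord ('X : {poly int}) k.+1) <= k.+1)%N by case.
elim: k => [|k [IH1 IH2]]; first by rewrite /= size_poly0 size_poly1.
split=> //; rewrite rchordSS; apply: leq_trans (size_polyD _ _) _.
rewrite geq_max size_polyN (leq_trans IH2) //=.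
have [->|nz] := eqVneq (rchord 'X k) (0 : {poly int}); first by rewrite mulr0 size_poly0.
by rewrite mulrC size_mulXn.
Qed.

(** It makes the constant coefficient of [pyramid_poly] equal to -2, which 4 does not divide, as
    Eisenstein's criterion requires. *)
Lemma coef0_rchordX k : (rchord ('X : {poly int}) k.+1)`_0 = 1.
Proof.
elim: k => [|k IHk]; first by rewrite coef1.
by rewrite rchordSS coefB IHk expr2 -mulrA coefXM subr0.
Qed.

(* Up to the factor -2, the reversal of [chord 'X p.+1 - 1/2]: its roots are the
   inverses of the roots of the latter, and it is Eisenstein at 2. *)
Definition pyramid_poly (p : nat) : {poly int} := 'X^p - rchord 'X p.+1 *+ 2.

Lemma coef_pyramid_poly p i :
  (pyramid_poly p)`_i = (i == p)%:R - (rchord 'X p.+1 : {poly int})`_i *+ 2.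
Proof. by rewrite coefB coefXn coefMn. Qed.

Lemma dvdz_mulr2n (x : int) : (2 %| x *+ 2)%Z.
Proof. by rewrite -[x *+ 2]mulr_natr dvdz_mull. Qed.

Lemma pyramid_lead_odd p : ~~ (2 %| (pyramid_poly p)`_p)%Z.
Proof.
by rewrite coef_pyramid_poly eqxx rpredBr ?dvdz_mulr2n.
Qed.

Lemma size_pyramid_poly p : size (pyramid_poly p) = p.+1.
Proof.
apply/eqP; rewrite eqn_leq; apply/andP; split.
  apply: leq_trans (size_polyD _ _) _; rewrite size_polyXn size_polyN geq_max leqnn.
  apply: leq_trans (size_rchordX p.+1); rewrite -mulr_natl.
  by apply: leq_trans (size_mul_leq _ _) _; rewrite -polyC_natr size_polyC.
rewrite ltnNge; apply: contra (pyramid_lead_odd p) => /leq_sizeP/(_ p (leqnn _)) ->.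
by rewrite dvdz0.
Qed.

Lemma pyramid_poly_irreducible p : (0 < p)%N ->
  irreducible_poly (map_poly (intr : int -> rat) (pyramid_poly p)).
Proof.
move=> p_gt0; apply/irreducible_rat_int/(@eisenstein_crit 2) => //.
- by rewrite size_pyramid_poly; case: p p_gt0.
- by rewrite lead_coefE size_pyramid_poly pyramid_lead_odd.
- rewrite coef_pyramid_poly [0%N == p]eq_sym gtn_eqF //.
  by rewrite coef0_rchordX.
- move=> i; rewrite size_pyramid_poly coef_pyramid_poly => /ltn_eqF ->.
  by rewrite sub0r rpredN dvdz_mulr2n.
Qed.

Lemma root_pyramid_poly (R : numFieldType) (y : R) (p : nat) :
  y != 0 -> chord y p.+1 = 2^-1 ->
  root (map_poly ratr (map_poly (intr : int -> rat) (pyramid_poly p))) y^-1.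
Proof.
move=> nz_y chy; rewrite -map_poly_comp.
rewrite (eq_map_poly (_ : ratr \o intr =1 intr)); last by move=> a /=; rewrite ratr_int.
rewrite rootE rmorphB rmorphMn rmorphXn (rmorph_rchord (map_poly intr)).
rewrite [X in X ^+ p]map_polyX [X in rchord X]map_polyX.
rewrite hornerD hornerN hornerMn hornerXn.
rewrite -/(horner_eval y^-1 (rchord _ _)) (rmorph_rchord (horner_eval y^-1)).
rewrite [X in rchord X]hornerX.
have nz_Vy : y^-1 != 0 by rewrite invr_neq0.
have := rchord_chord p.+1 nz_Vy; rewrite invrK chy exprS -mulrA => /(mulfI nz_Vy) ->.
by rewrite -mulr_natr mulfVK ?subrr // pnatr_eq0.
Qed.

(** * Realizations of the bipyramid *)

Section Geometry.
Variable R : realType.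
Implicit Types (a b c t u v w : pt3 R).

Definition det3 a b c : R := dot3 (cross3 a b) c.

(** Cramer's rule: a vector orthogonal to three independent vectors is orthogonal to every vector.
    Independence is read off from the Gram determinant [det3_gram]. *)
Lemma det3_cramer a b c u t :
  det3 a b c * dot3 u t = dot3 u a * det3 b c t + dot3 u b * det3 c a t
                        + dot3 u c * det3 a b t.
Proof.
by case: a b c u t => [[? ?] ?] [[? ?] ?] [[? ?] ?] [[? ?] ?] [[? ?] ?];
  rewrite /det3 /dot3 /cross3 /=; ring.
Qed.

Lemma det3_gram a b c :
  det3 a b c ^+ 2 = dot3 a a * dot3 b b * dot3 c c
    + 2 * dot3 a b * dot3 b c * dot3 a c - dot3 a a * dot3 b c ^+ 2
    - dot3 b b * dot3 a c ^+ 2 - dot3 c c * dot3 a b ^+ 2.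
Proof.
by case: a b c => [[? ?] ?] [[? ?] ?] [[? ?] ?];
  rewrite /det3 /dot3 /cross3 /=; ring.
Qed.

Lemma dot3_eq0 u : dot3 u u = 0 -> u = (0, 0, 0).
Proof.
case: u => [[x y] z]; rewrite /dot3 /= -!expr2 => /eqP.
rewrite paddr_eq0 ?addr_ge0 ?sqr_ge0 // paddr_eq0 ?sqr_ge0 // !sqrf_eq0.
by case/andP=> /andP[/eqP -> /eqP ->] /eqP ->.
Qed.

Lemma sub3_eq0 u v : sub3 u v = (0, 0, 0) -> u = v.
Proof.
case: u v => [[? ?] ?] [[? ?] ?] [] /=.
by move=> /subr0_eq -> /subr0_eq -> /subr0_eq ->.
Qed.

Lemma sub3_inj u v w : sub3 u w = sub3 v w -> u = v.
Proof.
by case: u v w => [[? ?] ?] [[? ?] ?] [[? ?] ?] [] /addIr -> /addIr -> /addIr ->.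
Qed.

(* [w] is the mirror image of [u] in the line spanned by [v]. *)
Lemma dot3_reflection u v w a t r s :
  dot3 u u = r -> dot3 v v = r -> dot3 w w = r -> dot3 u v = s -> dot3 v w = s ->
  dot3 u a = 0 -> dot3 v a = 0 -> dot3 w a = 0 ->
  r != 0 -> dot3 a a != 0 -> u != w ->
  r * dot3 w t = 2 * s * dot3 v t - r * dot3 u t.
Proof.
move=> uu vv ww uv vw ua va wa nz_r nz_a nuw.
have nz_d : dot3 (sub3 w u) (sub3 w u) != 0.
  by apply: contraNneq nuw => /dot3_eq0/sub3_eq0 ->.
(* The vector [r (w + u) - 2 s v], which vanishes if [w] is the mirror image. It is orthogonal to
   [v], [a] and [w - u], themselves nonzero and pairwise orthogonal. *)
pose x : pt3 R := (r * (w.1.1 + u.1.1) - 2 * s * v.1.1,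
   r * (w.1.2 + u.1.2) - 2 * s * v.1.2, r * (w.2 + u.2) - 2 * s * v.2).
have dotx y : dot3 x y = r * (dot3 w y + dot3 u y) - 2 * s * dot3 v y.
  by rewrite /dot3 /x /=; ring.
have dotd y : dot3 y (sub3 w u) = dot3 w y - dot3 u y.
  by rewrite /dot3 /sub3 /=; ring.
have dotC y y' : dot3 y y' = dot3 y' y by rewrite /dot3; ring.
have xv : dot3 x v = 0 by rewrite dotx vv uv dotC vw; ring.
have xa : dot3 x a = 0 by rewrite dotx wa ua va; ring.
have xd : dot3 x (sub3 w u) = 0.
  by rewrite dotd [dot3 w x]dotC [dot3 u x]dotC !dotx ww uu vw [dot3 v u]dotC uv
    [dot3 w u]dotC; ring.
have vd : dot3 v (sub3 w u) = 0 by rewrite dotd dotC vw uv subrr.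
have ad : dot3 a (sub3 w u) = 0 by rewrite dotd wa ua subrr.
have nz_det : det3 v a (sub3 w u) != 0.
  rewrite -sqrf_eq0 det3_gram vd ad va vv.
  rewrite !(mulr0, expr0n, subr0, addr0) /=.
  by rewrite !mulf_neq0.
have: det3 v a (sub3 w u) * dot3 x t = 0.
  by rewrite det3_cramer xv xa xd !mul0r !addr0.
move/eqP; rewrite mulf_eq0 (negPf nz_det) dotx /= => /eqP xt.
by lra.
Qed.

Definition pyramid_sides (m : nat) (i : nat) : nat := if (i < m)%N then 2 else 1.

Section Realization.
Variables (m b : nat) (P : nat -> pt3 R).
Hypothesis m_gt3 : (3 < m)%N.
Hypothesis rP : bipyramid_realization m.+1 (pyramid_sides m) b P.

Let No := P m.+1.
Let So := P m.+2.
(** Equator vertices relative to the midpoint of the poles: they lie on a circle of squared radius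
    [r] in the plane orthogonal to [ax]. *)
Let q i := sub3 (P i) ((No.1.1 + So.1.1) / 2, (No.1.2 + So.1.2) / 2, (No.2 + So.2) / 2).
Let ax := sub3 No So.
Let r := b%:R ^+ 2 - dot3 ax ax / 4.

Let dist_side i : (i < m)%N -> dist2 (P i) (P i.+1) = 4.
Proof.
move=> lt_im; have [/(_ i) + _] := rP.
rewrite (ltnW _) // modn_small // /pyramid_sides lt_im => -> //.
by rewrite -natrX.
Qed.

Let dist_last : dist2 (P 0%N) (P m) = 1.
Proof.
have [/(_ m) + _] := rP; rewrite ltnSn modnn /pyramid_sides ltnn expr1n => <- //.
by rewrite /dist2 /sub3 /dot3 /=; ring.
Qed.

Let face_neq f (w : nat) : f \in bipyramid_faces m.+1 -> (w < m.+3)%N -> ~~ in_face f w ->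
  orient (P f.1.1) (P f.1.2) (P f.2) (P w) != 0.
Proof.
move=> ff lt_w fw; have [_ [_ /(_ f ff w w lt_w lt_w fw fw)]] := rP.
by apply: contraTneq => ->; rewrite mul0r ltxx.
Qed.

Let face i : (i < m)%N -> (m.+1, i, i.+1) \in bipyramid_faces m.+1.
Proof.
move=> lt_im; rewrite mem_cat; apply/orP; left; apply/mapP; exists i.
  by rewrite mem_iota /= ltnS ltnW.
by rewrite modn_small.
Qed.

(** Convexity enters through this fact and [skip_neq]: a coincidence of vertices would put a vertex
    outside some face into the plane of that face. *)
Let axis_neq0 : dot3 ax ax != 0.
Proof.
have m_gt0 : (0 < m)%N by apply: leq_trans m_gt3.
have := face_neq (face m_gt0) (ltnSn _); rewrite /in_face /=.
rewrite (gtn_eqF (ltnSn _)) gtn_eqF; last by rewrite ltnS ltnW.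
move=> /(_ isT); apply: contraNneq => /dot3_eq0/sub3_eq0 NS.
by rewrite -/No -/So -NS /orient /sub3 /dot3 /=; apply/eqP; ring.
Qed.

Let skip_neq i : (i.+2 <= m)%N -> P i != P i.+2.
Proof.
move=> lt_im; have lt_im' : (i < m)%N by apply: leq_trans lt_im.
have := @face_neq _ i.+2 (face lt_im'); rewrite /in_face /=.
rewrite ltn_eqF // (gtn_eqF (ltnSn i.+1)) (gtn_eqF (_ : i < i.+2)%N) //.
rewrite (ltnW (ltnW _)) // => /(_ isT isT).
apply: contraNneq => <-.
by rewrite /orient /cross3 /sub3 /dot3 /=; apply/eqP; ring.
Qed.

Let poles i : (i <= m)%N -> dot3 (q i) (q i) = r /\ dot3 (q i) ax = 0.
Proof.
move=> le_im; have [_ [/(_ i le_im) + _]] := rP.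
rewrite -/No -/So /r /q /ax /dist2 /dot3 /sub3 /= => -[NP SP].
by split; lra.
Qed.

Let dist_q i j : (i <= m)%N -> (j <= m)%N -> 
  dist2 (P i) (P j) = 2 * r - 2 * dot3 (q i) (q j).
Proof.
move=> /poles[qi _] /poles[qj _].
transitivity (dot3 (q i) (q i) + dot3 (q j) (q j) - 2 * dot3 (q i) (q j)).
  by rewrite /q /dist2 /dot3 /sub3 /=; ring.
by rewrite qi qj; ring.
Qed.

Let dot_side i : (i < m)%N -> dot3 (q i) (q i.+1) = r - 2.
Proof.
by move=> lt_im; have := dist_side lt_im; rewrite (dist_q (ltnW lt_im) lt_im) => ?; lra.
Qed.

Let r_neq0 : r != 0.
Proof.
have m_gt0 : (0 < m)%N by apply: leq_trans m_gt3.
apply/eqP=> r0.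
have [q0 _] := poles (leq0n m); have [q1 _] := poles m_gt0.
have := dot_side m_gt0; rewrite (dot3_eq0 (etrans q0 r0)) (dot3_eq0 (etrans q1 r0)) r0.
by rewrite /dot3 /=; lra.
Qed.

(** Two consecutive sides have equal length, so [q i.+2] is the mirror image of [q i] in the line of
    [q i.+1]. *)
Let q_rec i : (i.+2 <= m)%N -> 
  r * dot3 (q 0%N) (q i.+2) = 2 * (r - 2) * dot3 (q 0%N) (q i.+1) - r * dot3 (q 0%N) (q i).
Proof.
have dotC y y' : dot3 y y' = dot3 y' y :> R by rewrite /dot3; ring.
move=> le_im; rewrite 3!(dotC (q 0%N)).
have lt_im : (i.+1 < m)%N := le_im; have le_i : (i < m)%N by apply: ltnW.
have [q1 a1] := poles (ltnW le_i); have [q2 a2] := poles le_i.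
have [q3 a3] := poles le_im.
apply: (dot3_reflection _ q1 q2 q3 (dot_side le_i) (dot_side lt_im) a1 a2 a3) => //.
by apply: contraNneq (skip_neq le_im) => /sub3_inj ->.
Qed.

(** The squared distance from vertex 0 to vertex [k] is [4 * chord y k ^+ 2], since both obey the
    same recurrence; the last side has length 1. *)
Lemma realization_chord y :
  y ^+ 2 = dist2 (P 0%N) (P 2) / 4 -> chord y m ^+ 2 = 4^-1.
Proof.
have m_gt1 : (2 <= m)%N by apply: leq_trans m_gt3.
move=> Dy.
(* The double angle formula, for [y = 2 cos t] and [r = 1 / sin t ^+ 2]. *)
have ry : r * (y ^+ 2 - 2) = 2 * (r - 2).
  rewrite Dy dist_q //; have := q_rec m_gt1; rewrite dot_side 1?ltnW //.
  have [-> _] := poles (leq0n m) => ?; lra.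
have dk k : (k.+1 <= m)%N -> 
    2 * r - 2 * dot3 (q 0%N) (q k) = 4 * chord y k ^+ 2 /\
    2 * r - 2 * dot3 (q 0%N) (q k.+1) = 4 * chord y k.+1 ^+ 2.
  elim: k => [|k IHk] le_km.
    rewrite dot_side //; have [-> _] := poles (leq0n m) => /=.
    by split; ring.
  have [d1 d2] := IHk (ltnW le_km); split=> //; apply: (mulfI r_neq0).
  rewrite chord_sqr.
  transitivity (2 * (r * (y ^+ 2 - 2)) * (2 * chord y k.+1 ^+ 2)
     - r * (4 * chord y k ^+ 2) + 8 * r); last by ring.
  rewrite ry -d1.
  transitivity (2 * r * r - 2 * (r * dot3 (q 0%N) (q k.+2))); first by ring.
  rewrite q_rec //.
  have -> : 2 * chord y k.+1 ^+ 2 = r - dot3 (q 0%N) (q k.+1) by lra.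
  ring.
have := dk m.-1; rewrite prednK ?(ltnW m_gt1) // leqnn => /(_ isT)[_].
by rewrite -dist_q // dist_last => ?; lra.
Qed.

End Realization.
End Geometry.

(** * Existence of the bipyramid *)

Section Existence.
Variable R : realType.

(** Each side of length 2 subtends the angle [2 th] at the centre. The equation makes the closing
    side have length 1, and the [m] equal sides span more than a half turn, so the centre is
    inside. *)
Lemma polygon_angle (m : nat) : (1 < m)%N ->
  exists th : R, [/\ 0 < th, pi / 2 < m%:R * th, m%:R * th < pi &
                     sin (m%:R * th) = sin th / 2].
Proof.
move=> m_gt1; have m_gt0 : 0 < m%:R :> R by rewrite ltr0n ltnW.
have m_ge2 : 2 <= m%:R :> R by rewrite ler_nat.
have pi0 := pi_gt0 R.
pose f x : R := sin (m%:R * x) - sin x / 2.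
(* At [a] the closing side would equal the others, and at [b] it would vanish; the intermediate
   value theorem gives half the common length in between. *)
pose a : R := pi / (m%:R + 1); pose b : R := pi / m%:R.
have mb : m%:R * b = pi by rewrite /b; field; rewrite gt_eqF.
have ma : (m%:R + 1) * a = pi by rewrite /a; field; rewrite gt_eqF // addr_gt0.
have a_gt0 : 0 < a by rewrite divr_gt0 // addr_gt0.
have b_gt0 : 0 < b by rewrite divr_gt0.
have le_ab : a <= b by rewrite ler_pM2l // lef_pV2 ?posrE ?addr_gt0 // lerDl.
have a_lt : a < pi by nra.
have b_lt : b < pi by nra.
have fa : 0 < f a.
  have -> : f a = sin a / 2.
    rewrite /f (_ : m%:R * a = - a + pi); last by rewrite -ma; ring.
    by rewrite sinDpi sinN; field.
  by rewrite divr_gt0 // sin_gt0_pi // a_gt0.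
have fb : f b < 0.
  by rewrite /f mb sinpi sub0r oppr_lt0 divr_gt0 // sin_gt0_pi // b_gt0.
have cf : {within `[a, b], continuous f}%classic.
  apply: continuous_subspaceT => x.
  apply: cvgB; last by apply: cvgMl; apply: continuous_sin.
  apply: continuous_comp; last exact: continuous_sin.
  by apply: cvgMr; apply: cvg_id.
have : Num.min (f a) (f b) <= 0 <= Num.max (f a) (f b).
  by rewrite ge_min le_max (ltW fa) (ltW fb) orbT.
case/(IVT le_ab cf) => th; rewrite in_itv /= => /andP[le_a le_b] fth.
exists th; split.
- exact: lt_le_trans le_a.
- have : m%:R * a <= m%:R * th by rewrite ler_pM2l.
  by apply: lt_le_trans; nra.
- have : m%:R * th <= pi by rewrite -mb ler_pM2l.
  rewrite le_eqVlt => /predU1P[eq_pi|//].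
  have thb : th = b by apply: (mulfI (lt0r_neq0 m_gt0)); rewrite mb.
  by move: fb; rewrite -thb fth ltxx.
- by apply/eqP; rewrite -subr_eq0 -[_ - _]/(f th) fth.
Qed.

Section Points.
Variables (m : nat) (th : R).
Hypotheses (m_gt1 : (1 < m)%N) (th_gt0 : 0 < th).
Hypotheses (mth_gt : pi / 2 < m%:R * th) (mth_lt : m%:R * th < pi).
Hypothesis sin_mth : sin (m%:R * th) = sin th / 2.

(** The equator vertices lie on a circle of radius [rho] at the angles [2 k th]. Half angles are
    used because chords and areas then factor into sines [sd] of differences. *)
Let c (k : nat) : R := cos (k%:R * th).
Let s (k : nat) : R := sin (k%:R * th).
Let sd i j := s j * c i - c j * s i.
Let cd i j := c j * c i + s j * s i.
Let rho := (sin th)^-1.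
Let x k := rho * (c k ^+ 2 - s k ^+ 2).
Let y k := rho * (2 * s k * c k).

Let th_lt : th < pi / 2.
Proof.
have : 2 * th <= m%:R * th by rewrite ler_pM2r // ler_nat.
by have := mth_lt; lra.
Qed.

Let sin_gt0 : 0 < sin th.
Proof. by apply: sin_gt0_pi; rewrite th_gt0 /=; have := pi_gt0 R; have := th_lt; lra. Qed.

Let c2s2 k : c k ^+ 2 + s k ^+ 2 = 1. Proof. exact: cos2Dsin2. Qed.

Let sdE i j : sd i j = sin (j%:R * th - i%:R * th). Proof. by rewrite sinB. Qed.
Let cdE i j : cd i j = cos (j%:R * th - i%:R * th). Proof. by rewrite cosB. Qed.
Let sdN i j : sd j i = - sd i j. Proof. by rewrite /sd; ring. Qed.

Let sd_gt0 i j : (i < j <= m)%N -> 0 < sd i j.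
Proof.
case/andP=> lt_ij le_jm; rewrite sdE -mulrBl.
have ij : 0 < j%:R - i%:R :> R by rewrite subr_gt0 ltr_nat.
have jm : j%:R <= m%:R :> R by rewrite ler_nat.
have i0 : 0 <= i%:R :> R by rewrite ler0n.
by have := mth_lt; have := th_gt0 => ? ?; apply: sin_gt0_pi; rewrite mulr_gt0 //=; nra.
Qed.

Let sdS i : sd i i.+1 = sin th.
Proof. by rewrite sdE -mulrBl -natrB // subSnn mul1r. Qed.
Let cdS i : cd i i.+1 = cos th.
Proof. by rewrite cdE -mulrBl -natrB // subSnn mul1r. Qed.

(** Twice the signed area of a triangle of equator vertices. *)
Let area i j k := (x i * y j - x j * y i) + (x j * y k - x k * y j)
                + (x k * y i - x i * y k).

(* In the next proofs [ring] needs both sides homogeneous in each [(c i, s i)], which the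
   factors [c i ^+ 2 + s i ^+ 2 = 1] achieve. *)
Let areaE i j k : area i j k = 4 * rho ^+ 2 * (sd i j * sd j k * sd i k).
Proof.
transitivity ((x i * y j - x j * y i) * (c k ^+ 2 + s k ^+ 2)
  + (x j * y k - x k * y j) * (c i ^+ 2 + s i ^+ 2)
  + (x k * y i - x i * y k) * (c j ^+ 2 + s j ^+ 2)).
  by rewrite !c2s2 !mulr1.
by rewrite /x /y /sd; ring.
Qed.

Let centralE i j : x i * y j - x j * y i = 2 * rho ^+ 2 * (sd i j * cd i j).
Proof. by rewrite /x /y /sd /cd; ring. Qed.

Let chordE i j : (x i - x j) ^+ 2 + (y i - y j) ^+ 2 = 4 * rho ^+ 2 * sd i j ^+ 2.
Proof.
transitivity (rho ^+ 2 * ((c i ^+ 2 + s i ^+ 2) ^+ 2 + (c j ^+ 2 + s j ^+ 2) ^+ 2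
  - 2 * ((c i ^+ 2 - s i ^+ 2) * (c j ^+ 2 - s j ^+ 2) + 4 * s i * c i * s j * c j))).
  by rewrite /x /y; ring.
transitivity (rho ^+ 2 * (2 * (c i ^+ 2 + s i ^+ 2) * (c j ^+ 2 + s j ^+ 2)
  - 2 * ((c i ^+ 2 - s i ^+ 2) * (c j ^+ 2 - s j ^+ 2) + 4 * s i * c i * s j * c j))).
  by rewrite !c2s2; ring.
by rewrite /sd; ring.
Qed.

Let radiusE i : x i ^+ 2 + y i ^+ 2 = rho ^+ 2.
Proof.
transitivity (rho ^+ 2 * (c i ^+ 2 + s i ^+ 2) ^+ 2); first by rewrite /x /y; ring.
by rewrite c2s2 expr1n mulr1.
Qed.

Let s0 : s 0%N = 0. Proof. by rewrite /s mul0r sin0. Qed.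
Let c0 : c 0%N = 1. Proof. by rewrite /c mul0r cos0. Qed.

Let rho_gt0 : 0 < rho. Proof. by rewrite invr_gt0. Qed.

Let cm_lt0 : c m < 0.
Proof.
rewrite -oppr_gt0 -sinBpihalf; apply: sin_gt0_pi.
by rewrite subr_gt0 mth_gt /=; have := pi_gt0 R; have := mth_lt; lra.
Qed.

Let sides i : (i <= m)%N -> let j := (i.+1 %% m.+1)%N in
  (x i - x j) ^+ 2 + (y i - y j) ^+ 2 = (pyramid_sides m i)%:R ^+ 2.
Proof.
have nz := lt0r_neq0 sin_gt0.
rewrite leq_eqVlt /pyramid_sides => /predU1P[->|lt_im] /=.
  rewrite modnn ltnn chordE /sd s0 c0 /s sin_mth /rho.
  by field.
by rewrite modn_small // lt_im chordE sdS /rho; field.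
Qed.

(** In the product of [areaE], the factors running against the order of the indices come in
    pairs. *)
Let area_gt0 i k : (i <= m)%N -> (k <= m)%N -> let j := (i.+1 %% m.+1)%N in
  k != i -> k != j -> 0 < area i j k.
Proof.
have pos (t : R) : 0 < t -> 0 < 4 * rho ^+ 2 * t.
  by move=> t0; rewrite !mulr_gt0 ?exprn_gt0.
rewrite leq_eqVlt => /predU1P[->|lt_im] le_km /=.
  rewrite modnn -lt0n => nkm k_gt0; rewrite areaE pos // [sd m 0%N]sdN [sd m k]sdN.
  have lt_km : (k < m)%N by rewrite ltn_neqAle nkm.
  rewrite !mulNr mulrN opprK !mulr_gt0 ?sd_gt0 ?leqnn ?lt_km ?k_gt0 ?(ltnW lt_km) //.
  by rewrite andbT (ltnW m_gt1).
rewrite modn_small // => nki nkj; rewrite areaE pos //.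
have [lt_ki|lt_ik|eq_ki] := ltngtP k i; last by rewrite eq_ki eqxx in nki.
  rewrite [sd i.+1 k]sdN [sd i k]sdN !mulrN mulNr opprK.
  by rewrite !mulr_gt0 ?sd_gt0 ?ltnSn ?lt_im ?lt_ki ?(ltnW lt_im) // ltnS ltnW.
have lt_jk : (i.+1 < k)%N by rewrite ltn_neqAle eq_sym nkj.
by rewrite !mulr_gt0 ?sd_gt0 ?ltnSn ?lt_im ?lt_ik ?lt_jk.
Qed.

(** The centre lies to the left of every side. For the short side this rests on [cm_lt0], that is on
    [m th > pi / 2]. *)
Let central_gt0 i : (i <= m)%N -> let j := (i.+1 %% m.+1)%N in
  0 < x i * y j - x j * y i.
Proof.
have pos (t : R) : 0 < t -> 0 < 2 * rho ^+ 2 * t.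
  by move=> t0; rewrite !mulr_gt0 ?exprn_gt0.
rewrite leq_eqVlt => /predU1P[->|lt_im] /=; rewrite centralE pos //.
  rewrite modnn /cd s0 c0 sdN mul0r mul1r addr0 nmulr_rgt0 // oppr_lt0.
  by rewrite sd_gt0 // leqnn andbT ltnW.
rewrite modn_small // sdS cdS mulr_gt0 //.
by apply: cos_gt0_pihalf; rewrite th_lt andbT; have := pi_gt0 R; have := th_gt0; lra.
Qed.

Variable b : nat.
Hypothesis b_gt : rho < b%:R.
Let h := Num.sqrt (b%:R ^+ 2 - rho ^+ 2).
Let h_gt0 : 0 < h.
Proof. by rewrite sqrtr_gt0 subr_gt0 ltr_pXn2r ?nnegrE ?ltW // (lt_trans rho_gt0). Qed.
Let h2 : h ^+ 2 = b%:R ^+ 2 - rho ^+ 2.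
Proof. by rewrite sqr_sqrtr //; have := h_gt0; rewrite sqrtr_gt0 => /ltW. Qed.

Definition pyramid_points (k : nat) : pt3 R :=
  if (k <= m)%N then (x k, y k, 0) else
  if k == m.+1 then (0, 0, h) else (0, 0, - h).

Let P := pyramid_points.
Let PE k : (k <= m)%N -> P k = (x k, y k, 0).
Proof. by rewrite /P /pyramid_points => ->. Qed.
Let P1 : P m.+1 = (0, 0, h).
Proof. by rewrite /P /pyramid_points ltnn eqxx. Qed.
Let P2 : P m.+2 = (0, 0, - h).
Proof. by rewrite /P /pyramid_points ltnNge leqnSn /= gtn_eqF. Qed.

(** The sign depends on the pole [e] alone, so all other vertices are on one side. An equator vertex
    contributes [area], the opposite pole the triangle at the centre. *)
Let orient_face (e : R) i w : (i <= m)%N -> (w < m.+3)%N -> e = h \/ e = - h ->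
  let j := (i.+1 %% m.+1)%N in w != i -> w != j -> P w != (0, 0, e) ->
  exists2 t, 0 < t & orient (0, 0, e) (P i) (P j) (P w) = - e * t.
Proof.
move=> le_im lt_w eh j nwi nwj nwe.
have le_jm : (j <= m)%N by rewrite -ltnS ltn_mod.
rewrite (PE le_im) (PE le_jm).
have [le_wm|lt_mw] := leqP w m.
  exists (area i j w); first exact: area_gt0.
  by rewrite (PE le_wm) /orient /dot3 /cross3 /sub3 /area /=; ring.
exists (2 * (x i * y j - x j * y i)); first by apply: mulr_gt0 => //; exact: central_gt0.
have -> : P w = (0, 0, - e).
  have : (w == m.+1) || (w == m.+2) by lia.
  case/orP=> /eqP Dw; move: nwe; rewrite Dw ?P1 ?P2; case: eh => ->;
    by rewrite ?opprK ?eqxx.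
by rewrite /orient /dot3 /cross3 /sub3 /=; ring.
Qed.

Lemma pyramid_pointsP : bipyramid_realization m.+1 (pyramid_sides m) b P.
Proof.
split=> [i le_im|].
  rewrite -sides // !PE //; last by rewrite -ltnS ltn_mod.
  by rewrite /dist2 /dot3 /sub3 /=; ring.
split=> [i le_im|].
  rewrite P1 P2 PE // /dist2 /dot3 /sub3 /= -[b%:R ^+ 2](subrK (rho ^+ 2)) -h2.
  by rewrite -(radiusE i); split; ring.
have main e i w1 w2 : (i <= m)%N -> e = h \/ e = - h ->
    (w1 < m.+3)%N -> (w2 < m.+3)%N -> let j := (i.+1 %% m.+1)%N in
    w1 != i -> w1 != j -> P w1 != (0, 0, e) -> 
    w2 != i -> w2 != j -> P w2 != (0, 0, e) -> 
    0 < orient (0, 0, e) (P i) (P j) (P w1) * orient (0, 0, e) (P i) (P j) (P w2).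
  move=> le_im eh lt_w1 lt_w2 j n1 n2 n3 n4 n5 n6.
  have [t1 t1_gt0 ->] := orient_face le_im lt_w1 eh n1 n2 n3.
  have [t2 t2_gt0 ->] := orient_face le_im lt_w2 eh n4 n5 n6.
  rewrite mulrACA mulrNN; apply: mulr_gt0; last exact: mulr_gt0.
  by case: eh => ->; rewrite ?mulrNN mulr_gt0.
have hN : - h < 0 by rewrite oppr_lt0.
(* As [h] is positive, each pole differs from all other vertices, so distinct indices give the
   distinct points that [main] asks for. *)
have P1P w : P w = (0, 0, h) -> w = m.+1.
  rewrite /P /pyramid_points; case: leqP => [_ [_ _ h0]|_].
    by move: h_gt0; rewrite -h0 ltxx.
  by case: eqP => // _ [hh]; move: h_gt0 hN; rewrite hh => /ltW; rewrite leNgt => /negbTE ->.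
have P2P w : (w < m.+3)%N -> P w = (0, 0, -h) -> w = m.+2.
  move=> lt_w; rewrite /P /pyramid_points; case: leqP => [_ [_ _ h0]|lt_mw].
    by move: hN; rewrite -h0 ltxx.
  case: eqP => [_ [hh]|/eqP nw _]; last by lia.
  by move: h_gt0 hN; rewrite -hh => /ltW; rewrite leNgt => /negbTE ->.
move=> f; rewrite mem_cat => /orP[] /mapP[i]; rewrite mem_iota /= ltnS => le_im ->;
  move=> w1 w2 lt1 lt2; rewrite /in_face /= !negb_or => /and3P[n1 n2 n3] /and3P[n4 n5 n6].
  rewrite P1; apply: main => //; first by left.
    by apply: contraNneq n1 => /P1P ->.
  by apply: contraNneq n4 => /P1P ->.
rewrite P2; apply: main => //; first by right.
  by apply: contraNneq n1 => /(P2P _ lt1) ->.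
by apply: contraNneq n4 => /(P2P _ lt2) ->.
Qed.
End Points.

Theorem pyramid_exists (m : nat) : (1 < m)%N ->
  exists (b : nat) (P : nat -> pt3 R), bipyramid_realization m.+1 (pyramid_sides m) b P.
Proof.
move=> m_gt1; have [th [th_gt0 mth_gt mth_lt sin_mth]] := polygon_angle m_gt1.
(* Any integer above the circumradius [1 / sin th] can be the length of the pole edges. *)
exists (Num.bound (sin th)^-1), (pyramid_points m th (Num.bound (sin th)^-1)).
apply: pyramid_pointsP => //; apply: archi_boundP.
have m_ge1 : 1 <= m%:R :> R by rewrite ler1n ltnW.
rewrite invr_ge0 sin_ge0_pi // (ltW th_gt0) /=.
by apply: le_trans (ltW mth_lt); rewrite ler_peMl // ltW.
Qed.
End Existence.

(** * Impossibility *)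

(** The output gives [y ^+ 2], so one square root is appended to the tower. Then [chord y p.+1] is
    [1/2] or [-1/2], and being odd in [y] it becomes [1/2] at [y] or [- y]. *)
Lemma output_chord (R : realType) (step : seq R -> R -> Prop) s out (p b : nat) :
  (forall s v, v ^+ 2 \in gen s -> step s v) ->
  tower step s -> {subset out <= gen s} -> odd p -> (2 < p)%N ->
  bipyramid_realization p.+2 (pyramid_sides p.+1) b (out_points out) ->
  exists s' x, [/\ tower step s', x \in gen s', x != 0 & chord x p.+1 = 2^-1].
Proof.
move=> sqrt_step ts souts odd_p p_gt2 rP.
pose D := dist2 (out_points out 0%N) (out_points out 2).
have Dge0 : 0 <= D / 4.
  by rewrite divr_ge0 // /D /dist2 /dot3 -!expr2 !addr_ge0 ?sqr_ge0.
have Ds : D / 4 \in gen s.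
  have g k : nth 0 out k \in gen s by apply: nth_gen.
  apply: rpred_div; last exact: rpred_nat.
  by rewrite /D /dist2 /dot3 /sub3 /= !rpredD ?rpredM ?rpredB.
pose y := Num.sqrt (D / 4); have y2 : y ^+ 2 = D / 4 by rewrite sqr_sqrtr.
have ts' : tower step (rcons s y).
  by apply: tower_rcons => //; apply: sqrt_step; rewrite y2.
have yg : y \in gen (rcons s y) by apply: mem_gen; rewrite mem_rcons mem_head.
have half0 : 2^-1 != 0 :> R by rewrite invr_eq0 pnatr_eq0.
have nz (x : R) : chord x p.+1 = 2^-1 -> x != 0.
  have c0 : chord (0 : R) p.+1 = 0.
    have /eqP := chord_opp (0 : R) p; rewrite oppr0 -signr_odd odd_p expr1 mulN1r.
    by rewrite -addr_eq0 -mulr2n mulrn_eq0 orFb => /eqP.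
  by move=> chx; apply: contraNneq half0 => x0; rewrite -chx x0 c0.
have := realization_chord (m := p.+1) p_gt2 rP y2.
rewrite (_ : 4^-1 = 2^-1 ^+ 2 :> R); last by field.
move/eqP; rewrite eqf_sqr => /orP[]/eqP chy.
  by exists (rcons s y), y; split=> //; apply: nz.
have chNy : chord (- y) p.+1 = 2^-1.
  by rewrite chord_opp -signr_odd odd_p chy expr1 mulN1r opprK.
by exists (rcons s y), (- y); split; rewrite ?rpredN // nz.
Qed.

(** The cubic [X^3 - 2 X - 1/2] changes sign on [[-1, 0]] and on [[0, 2]], and is nonzero at 0. *)
Lemma chord4_two_roots (R : realType) :
  exists x y : R, [/\ x != y, x != 0, y != 0, chord x 4 = 2^-1 & chord y 4 = 2^-1].
Proof.
pose f : {poly R} := 'X^3 - 2%:P * 'X - (2^-1)%:P.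
have fE t : f.[t] = chord t 4 - 2^-1.
  by rewrite /f !hornerE /=; ring.
have f0 : f.[0] = - 2^-1 by rewrite fE /=; ring.
have half0 : 0 < 2^-1 :> R by rewrite invr_gt0.
have fN1 : f.[-1] = 2^-1 by rewrite fE /=; field.
have f2 : f.[2] = 4 - 2^-1 by rewrite fE /=; ring.
have [x /andP[_ x_le0] fx] : exists2 x, -1 <= x <= 0 & root (- f) x.
  by apply: poly_ivt; rewrite ?oppr_le0 ?ler01 // !hornerN f0 fN1; lra.
have [y /andP[y_ge0 _] fy] : exists2 x, 0 <= x <= 2 & root f x.
  by apply: poly_ivt; rewrite // f0 f2; lra.
have {}fx : f.[x] = 0 by apply/eqP; rewrite -oppr_eq0 -hornerN.
have {}fy : f.[y] = 0 by apply/eqP.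
have nz t : f.[t] = 0 -> t != 0.
  by apply: contra_eq_neq => ->; rewrite f0; lra.
exists x, y; split; try exact: nz; try by apply/eqP; rewrite -subr_eq0 -fE ?fx ?fy.
by rewrite lt_eqF // lt_neqAle (le_trans x_le0) // andbT; have := nz _ fx; lra.
Qed.

Theorem theorem13 :
  (forall R : realType,
     ~ exists A : nat -> ctree,
         (forall n, radical_tree (A n)) /\ computes_bipyramids R A) /\
  (forall (R : realType) (d : nat),
     ~ exists A : nat -> ctree,
         (forall n, root_tree d (A n)) /\ computes_bipyramids R A).
Proof.
split=> [R [A [radA compA]]|R d [A [rootA compA]]].
(* Here [p = 3], with four sides of length 2 and one of length 1. *)
- have [b exP] := @pyramid_exists R 4 isT.
  have [out [ev [_ rP]]] := compA 5%N (pyramid_sides 4) b isT exP.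
  have [|m' tm' outm'] := ceval_radical_tower ev (radA _).
    by apply: tower_input => s v; apply: gen_radical_step.
  have [|s [x [ts sx nz_x chx]]] := output_chord _ tm' outm' (isT : odd 3) isT rP.
    by move=> s v sv; exists 2.
  have [y [z [nyz nz_y nz_z chy chz]]] := chord4_two_roots R.
  have irr := @pyramid_poly_irreducible 3 isT.
  have sz : size (map_poly (intr : int -> rat) (pyramid_poly 3)) = 4%N.
    by rewrite size_map_inj_poly ?size_pyramid_poly //; apply: intr_inj.
  (* Every real solution is identified with the computed [x], which contradicts [y != z]. *)
  have one t : t != 0 -> chord t 4 = 2^-1 -> x^-1 = t^-1.
    move=> nz_t cht; apply: (radical_tower_one_root ts _ irr) sz => //.
    + by rewrite rpredV.
    + exact: root_pyramid_poly.
    + exact: root_pyramid_poly.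
  case/eqP: nyz; apply: invr_inj.
  by rewrite -(one y) // -(one z).
(* The bound 2 admits the square root of [output_chord] among the steps and forces [p] to be odd. *)
- have [p lt_p p_pr] := prime_above (maxn d 2).
  have lt_2p : (2 < p)%N by apply: leq_ltn_trans lt_p; apply: leq_maxr.
  have odd_p : odd p by case: (even_prime p_pr) lt_2p => // ->.
  have [b exP] := @pyramid_exists R p.+1 (ltnW (ltnW lt_2p)).
  have [out [ev [_ rP]]] := compA p.+2 (pyramid_sides p.+1) b (ltnW (ltnW lt_2p)) exP.
  have D_gt0 : (0 < maxn d 2)%N by rewrite leq_max orbT.
  have [|m' tm' outm'] := ceval_root_tower D_gt0 (leq_maxl d 2) ev (rootA _).
    by apply: tower_input => s v; apply: gen_root_step.
  have [|s [x [ts sx nz_x chx]]] := output_chord _ tm' outm' odd_p lt_2p rP.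
    by move=> s v /(radical_root_step (ltn0Sn 1)); apply/root_stepW/leq_maxr.
  apply: (root_tower_degree ts (rpredVr sx) (pyramid_poly_irreducible (prime_gt0 p_pr))
    (root_pyramid_poly nz_x chx) p_pr _ lt_p).
  by rewrite size_map_inj_poly ?size_pyramid_poly //; apply: intr_inj.
Qed.
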